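(* Let $\mathbb{F}_4$ be the free group on $g_1,g_2,g_3,g_4$, let $\rho:\mathbb{F}_4\to\mathbb{H}^\times$ be the homomorphism with $\rho(g_i)=q_i$ ($i=1,2,3,4$), let $w\in\mathbb{F}_4$, let $x=(x_0,x_1,x_2,x_3)=\rho(w)$ be its quaternion representation, and let $k\in\{0,1,2,3\}$. Then the following three conditions are equivalent: (a) $\|w\|_k=0$; (b) ${\rm red}_k(w)=1$; (c) either $k=0$ and $x=1$, or $k>0$ and $x_k=0$. If these conditions do not hold, then $${\rm lad}(x_k)=\|w\|_k\ge 1 .$$
   Context: Quaternions: $(x_0,x_1,x_2,x_3)$ denotes $x_0+x_1 i_1+x_2 i_2+x_3 i_3\in\mathbb{H}$, where $i_1,i_2,i_3$ are Hamilton's $i,j,k$. The simplex vertices are $$q_1=\left(-\tfrac14,\tfrac{\sqrt5}{4},\tfrac{\sqrt5}{4},\tfrac{\sqrt5}{4}\right),\quad q_2=\left(-\tfrac14,-\tfrac{\sqrt5}{4},-\tfrac{\sqrt5}{4},\tfrac{\sqrt5}{4}\right),$$ $$q_3=\left(-\tfrac14,\tfrac{\sqrt5}{4},-\tfrac{\sqrt5}{4},-\tfrac{\sqrt5}{4}\right),\quad q_4=\left(-\tfrac14,-\tfrac{\sqrt5}{4},\tfrac{\sqrt5}{4},-\tfrac{\sqrt5}{4}\right).$$ Permutations: $\pi_0={\rm id}$, and for $k=1,2,3$, $\pi_k$ is the permutation of $\{1,2,3,4\}$ with $i_k q_i i_k^{-1}=q_{\pi_k(i)}$; explicitly $\pi_1=(1\,3)(2\,4)$,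 $\pi_2=(1\,4)(2\,3)$, $\pi_3=(1\,2)(3\,4)$. Each $\pi_k$ is extended to the automorphism of $\mathbb{F}_4$ with $\pi_k(g_i)=g_{\pi_k(i)}$. Alternating norm: every element $w$ of a free group with generators $g_1,\dots,g_m$ has a unique alternating pairs expression $$w=(a_1a_2^{-1})(a_3a_4^{-1})\cdots(a_{2n-1}a_{2n}^{-1})$$ in which consecutive terms are distinct and the first is nontrivial, $1\ne a_1$, $a_1\ne a_2$, $a_2\neq a_3$, $\dots$, $a_{2n-1}\ne a_{2n}$, and either all $a_i\in\{1,g_1,\dots,g_m\}$ or all $a_i\in\{1,g_1^{-1},\dots,g_m^{-1}\}$. One sets $|w|_{\rm alt}=n$, the number of pairs (so $|1|_{\rm alt}=0$). $k$-reduction: ${\rm red}_k(w)$ is obtained from the reduced word $w$ by cancelling a letter $g^{\pm1}$ at the beginning of the word with a letter $\pi_k(g)^{\mp1}$ at its end ($g$ a generator), i.e. replacing a reduced word $g^{\pm1}v\,\pi_k(g)^{\mp1}$ by $v$, repeated as long as this is possible. The reduced $k$-alternating norm is $\|w\|_k=|{\rm red}_k(w)|_{\rm alt}$. Shifted logarithm of the algebraic denominator: an algebraic integer $y$ is called even if $y/2$ is an algebraic integer, and odd otherwise. For an algebraic number of the form $x=y/2^{m+1}$ with $m\in\mathbb{Z}$ and $y$ an odd algebraic integer, ${\rm lad}(x)=m$; and ${\rm lad}(0)=-\infty$. *)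

(* Defs.v *)
From HB Require Import structures.
From mathcomp Require Import all_boot all_order all_algebra.
From mathcomp Require Import all_fingroup.
From mathcomp Require Import ring.
From mathcomp Require Import boolp classical_sets reals constructive_ereal.

Set Implicit Arguments.
Unset Strict Implicit.
Unset Printing Implicit Defensive.

Import Order.TTheory GRing.Theory Num.Theory.

(* The free group on a finite set T of generators, as the type of reduced
   words. The letter (t, false) stands for t and (t, true) for t^-1. *)
Section FreeGroup.
Variable T : finType.
Implicit Types (l : T * bool) (s : seq (T * bool)).

Definition linv l : T * bool := (l.1, ~~ l.2).

Definition reduced s := sorted (fun l l' => l' != linv l) s.

Record free_group := Free { word :> seq (T * bool); word_reduced : reduced word }.

HB.instance Definition _ := [isSub for word].
HB.instance Definition _ := [Choice of free_group by <:].

Lemma linvK : involutive linv.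
Proof. by case=> t b; rewrite /linv /= negbK. Qed.

Lemma eq_linv l l' : (l' == linv l) = (l == linv l').
Proof. by apply/eqP/eqP => ->; rewrite linvK. Qed.

(* Left multiplication of a reduced word by a letter. *)
Definition lmul l s :=
  if s is l' :: s' then if l' == linv l then s' else l :: s else [:: l].

Lemma reduced_tail l s : reduced (l :: s) -> reduced s.
Proof. exact: path_sorted. Qed.

Lemma lmul_reduced l s : reduced s -> reduced (lmul l s).
Proof.
case: s => [|l' s] //= red_s; case: eqP => [_|/eqP ne]; first exact: path_sorted red_s.
by rewrite /reduced /= ne.
Qed.

Lemma lmul_cons l s : reduced (l :: s) -> lmul l s = l :: s.
Proof. by case: s => [|l' s] //= /andP[/negPf->]. Qed.

Lemma lmulK l s : reduced s -> lmul l (lmul (linv l) s) = s.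
Proof.
case: s => [|l' s] /= red_s; first by rewrite eqxx.
rewrite linvK; case: eqP => [<-|_]; first by rewrite lmul_cons.
by rewrite /= eqxx.
Qed.

Definition wmul s1 s2 := foldr lmul s2 s1.

Lemma wmul_reduced s1 s2 : reduced s2 -> reduced (wmul s1 s2).
Proof. by move=> red2; elim: s1 => //= l s1; apply: lmul_reduced. Qed.

Lemma wmul_lmul l s1 s2 :
  reduced s2 -> wmul (lmul l s1) s2 = lmul l (wmul s1 s2).
Proof.
move=> red2; case: s1 => [|l' s1] //=; case: eqP => // ->.
by rewrite lmulK // wmul_reduced.
Qed.

Lemma wmulA s1 s2 s3 :
  reduced s3 -> wmul s1 (wmul s2 s3) = wmul (wmul s1 s2) s3.
Proof. by move=> red3; elim: s1 => //= l s1 ->; rewrite wmul_lmul. Qed.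

Lemma wmuls0 s : reduced s -> wmul s [::] = s.
Proof.
elim: s => //= l s IHs red_s.
by rewrite IHs ?lmul_cons //; apply: reduced_tail red_s.
Qed.

Definition winv s := rev (map linv s).

Lemma winvK : involutive winv.
Proof. by move=> s; rewrite /winv map_rev revK mapK //; apply: linvK. Qed.

Lemma winv_reduced s : reduced s -> reduced (winv s).
Proof.
rewrite /reduced /winv rev_sorted sorted_map.
by apply: sub_sorted => l l' /=; rewrite linvK eq_sym.
Qed.

Lemma wmul_rcons s1 l s2 : wmul (rcons s1 l) s2 = wmul s1 (lmul l s2).
Proof. by rewrite /wmul foldr_rcons. Qed.

Lemma wmulVs s : wmul (winv s) s = [::].
Proof.
rewrite /winv; elim: s => //= l s IHs.
by rewrite rev_cons wmul_rcons /= linvK eqxx.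
Qed.

Definition fone : free_group := @Free [::] isT.
Definition fmul (u v : free_group) : free_group := Free (wmul_reduced u (word_reduced v)).
Definition finv (u : free_group) : free_group := Free (winv_reduced (word_reduced u)).

Fact fmulA : associative fmul.
Proof. by move=> u v w; apply/val_inj/wmulA/word_reduced. Qed.
Fact fmul1g : left_id fone fmul.
Proof. by move=> u; apply/val_inj. Qed.
Fact fmulg1 : right_id fone fmul.
Proof. by move=> u; apply/val_inj/wmuls0/word_reduced. Qed.
Fact fmulVg : left_inverse fone finv fmul.
Proof. by move=> u; apply/val_inj/wmulVs. Qed.
Fact fmulgV : right_inverse fone finv fmul.
Proof. by move=> u; apply/val_inj; rewrite /= -{1}(winvK u) wmulVs. Qed.

HB.instance Definition _ := isGroup.Build free_group fmulA fmul1g fmulg1 fmulVg fmulgV.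

Definition free_gen (t : T) : free_group := @Free [:: (t, false)] isT.

End FreeGroup.

Section AlternatingNorm.
Variable T : finType.
Local Open Scope group_scope.
Implicit Types (w a : free_group T) (E : seq (free_group T * free_group T)).

(* a is 1 or a generator (e = false), resp. 1 or the inverse of a generator
   (e = true). *)
Definition is_alt_term (e : bool) a :=
  (a == 1) || [exists t, a == if e then (free_gen t)^-1 else free_gen t].

(* E lists the pairs (a_1, a_2), (a_3, a_4), ... of an alternating pairs
   expression of w; the path starts at 1, which gives 1 <> a_1. *)
Definition is_alt_expr w E :=
  let A := flatten [seq [:: p.1; p.2] | p <- E] in
  [&& w == \prod_(p <- E) (p.1 * p.2^-1),
      path (fun a b => a != b) 1 A &
      all (is_alt_term false) A || all (is_alt_term true) A].

Let letter (l : T * bool) : free_group T := @Free T [:: l] isT.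

Fixpoint alt_parse (e : bool) (s : seq (T * bool)) : seq (free_group T * free_group T) :=
  if s isn't l :: s1 then [::] else
  if l.2 != e then (1, (letter l)^-1) :: alt_parse e s1 else
  if s1 isn't l2 :: s2 then [:: (letter l, 1)] else
  if l2.2 != e then (letter l, (letter l2)^-1) :: alt_parse e s2
  else (letter l, 1) :: alt_parse e s1.

Lemma letterV l : (letter l)^-1 = letter (linv l).
Proof. exact/val_inj. Qed.

Lemma is_alt_termP e a :
  reflect (a = 1 \/ exists t, a = letter (t, e)) (is_alt_term e a).
Proof.
apply: (iffP orP) => [[/eqP->|/existsP[t /eqP->]]|[->|[t ->]]]; try by left.
  by right; exists t; case: e => //; apply: val_inj.
by right; apply/existsP; exists t; apply/eqP; case: e => //; apply: val_inj.
Qed.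

Lemma free_prod w : w = \prod_(l <- word w) letter l.
Proof.
case: w => s red_s /=; elim: s red_s => [|l s IHs] red_s.
  by rewrite big_nil; apply: val_inj.
rewrite big_cons -(IHs (reduced_tail red_s)); apply: val_inj => /=.
by rewrite lmul_cons.
Qed.

Lemma alt_parse_spec (e : bool) s a :
    reduced s ->
    (if s is l :: _ then a != if l.2 == e then letter l else 1 else true) ->
  let A := flatten [seq [:: p.1; p.2] | p <- alt_parse e s] in
  [/\ \prod_(l <- s) letter l = \prod_(p <- alt_parse e s) (p.1 * p.2^-1),
      path (fun a b => a != b) a A & all (is_alt_term e) A].
Proof.
have [n] := ubnP (size s); elim: n s a => // n IHn s a.
case: s => [|l s]; first by rewrite !big_nil.
rewrite ltnS => le_s red_s.
have t1 : is_alt_term e 1 by apply/is_alt_termP; left.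
have tl l1 : l1.2 = e -> is_alt_term e (letter l1).
  by move=> <-; apply/is_alt_termP; right; exists l1.1; case: l1.
have tV l1 : l1.2 != e -> is_alt_term e (letter l1)^-1.
  by rewrite letterV => ne; apply: tl; move: ne => /=; case: (l1.2); case: (e).
have nV l1 l2 : l2 != linv l1 -> (letter l1)^-1 != letter l2.
  by rewrite letterV; apply: contra_neq => -[].
have next1 l1 s1 : reduced (l1 :: s1) -> size s1 <= size s -> l1.2 != e ->
  let A := flatten [seq [:: p.1; p.2] | p <- alt_parse e s1] in
  [/\ \prod_(l <- s1) letter l = \prod_(p <- alt_parse e s1) (p.1 * p.2^-1),
      path (fun a b => a != b) (letter l1)^-1 A & all (is_alt_term e) A].
  move=> red1 le1 ne; apply: IHn; first exact: leq_ltn_trans le_s.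
    exact: reduced_tail red1.
  by case: s1 red1 {le1} => // l2 s1 /= /andP[/nV h _]; case: ifP.
case: ifPn => [/eqP le a_l|ne a_l] /=; last first.
  rewrite ne !big_cons /= invgK mul1g tV // a_l.
  by have [-> -> ->] := next1 _ _ red_s (leqnn _) ne; split; rewrite ?eq_sym.
rewrite le eqxx /=; case: s => [|l2 s] /= in le_s red_s next1 *.
  by rewrite !big_cons !big_nil /= a_l tl ?invg1 ?mulg1.
case: ifPn => [ne2|/negPn/eqP le2] /=.
  have red2 : reduced (l2 :: s) by case/andP: red_s.
  rewrite !big_cons /=; have [-> -> ->] := next1 _ _ red2 (leqnSn _) ne2.
  rewrite invgK mulgA a_l tl // tV //; split=> //.
  have [nl _] := andP red_s; rewrite eq_linv in nl.
  by rewrite andbT /= letterV; apply: contra_neq nl; case.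
have red2 : reduced (l2 :: s) by case/andP: red_s.
have [|] := IHn (l2 :: s) 1 le_s red2; first by rewrite le2 eqxx.
rewrite /= le2 eqxx /= => prodE pathE altE.
by rewrite big_cons prodE [RHS]big_cons /= a_l tl // invg1 mulg1 pathE altE.
Qed.

Lemma alt_expr_exists w : exists E, is_alt_expr w E.
Proof.
pose e := if word w is l :: _ then l.2 else false.
exists (alt_parse e (word w)); rewrite /is_alt_expr.
have [|prodE -> altE] := @alt_parse_spec e (word w) 1 (word_reduced w).
  by rewrite /e; case: (word w) => // l s; rewrite eqxx.
rewrite -prodE -free_prod eqxx /=.
by move: altE; case: (e) => -> //; rewrite orbT.
Qed.

Let letters E := flatten [seq word p.1 ++ word (p.2)^-1 | p <- E].

Lemma prod_letters E :
  \prod_(p <- E) (p.1 * p.2^-1) = \prod_(l <- letters E) letter l.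
Proof.
rewrite big_flatten big_map; apply: eq_bigr => p _.
by rewrite big_cat -!free_prod.
Qed.

Lemma alt_parseK (e : bool) a E :
  is_alt_term e a ->
  let A := flatten [seq [:: p.1; p.2] | p <- E] in
  path (fun a b => a != b) a A -> all (is_alt_term e) A ->
  [/\ reduced (word a^-1 ++ letters E), alt_parse e (letters E) = E &
      a = 1 -> if letters E is l :: _ then l.2 == e else true].
Proof.
have neq_e : (~~ e != e) = true by case: (e).
have letter_inj l l' : letter l != letter l' -> l != l'.
  by apply: contra_neq => ->.
have path1 t s : reduced s -> (if s is l :: _ then l.2 == e else true) ->
    path (fun l l' : T * bool => l' != (l.1, ~~ l.2)) (t, e) s.
  case: s => //= l s -> /eqP le; rewrite andbT.
  by apply/eqP => lE; move: le; rewrite lE /=; case: (e).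
have parse1 t s E' : alt_parse e s = E' ->
    (if s is l :: _ then l.2 == e else true) ->
    alt_parse e ((t, e) :: s) = (letter (t, e), 1) :: E'.
  by move=> <-; rewrite /= eqxx; case: s => [|l s] //= ->.
elim: E a => [|[x y] E IHE] a /is_alt_termP alt_a.
  by move=> A _ _; split=> //; rewrite /letters cats0; apply: (word_reduced a^-1).
move=> /= /and3P[nax nxy pathE] /and3P[/is_alt_termP alt_x alt_y altE].
have [] := IHE y alt_y pathE altE; rewrite {IHE pathE altE} /letters /=.
move: (flatten _) => s; case/is_alt_termP: alt_y => [yE|[v yE]]; subst y;
  case: alt_x nax nxy => [->|[t ->]] //; case: alt_a => [->|[u ->]] //=;
  rewrite ?invg1 ?letterV /linv /= ?eqxx ?negbK //.
- move=> _ _ red_s parse_s /(_ erefl) hs; split=> //; first exact: path1.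
  by have := parse1 t s E parse_s hs; rewrite /= eqxx.
- move=> /letter_inj ut _ red_s parse_s /(_ erefl) hs; split=> //.
    by rewrite eq_sym ut path1.
  by have := parse1 t s E parse_s hs; rewrite /= eqxx.
- move=> _ _ red_s -> _.
  by rewrite red_s xpair_eqE negb_and neq_e orbT; split=> // /(congr1 val).
- move=> _ /letter_inj tv red_s -> _; rewrite red_s neq_e andbT; split=> //.
  by apply: contra_neq tv => -[->].
- move=> /letter_inj ut /letter_inj tv red_s -> _.
  rewrite red_s neq_e andbT (eq_sym (t, e)) ut; split=> //=.
  by apply: contra_neq tv => -[->].
Qed.

Lemma alt_expr_unique w E1 E2 :
  is_alt_expr w E1 -> is_alt_expr w E2 -> E1 = E2.
Proof.
suff parseE E : is_alt_expr w E ->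
    E = alt_parse (if word w is l :: _ then l.2 else false) (word w).
  by move=> /parseE-> /parseE->.
case/and3P=> /eqP wE pathE altE; rewrite prod_letters in wE.
have [e {}altE] : exists e,
    all (is_alt_term e) (flatten [seq [:: p.1; p.2] | p <- E]).
  by case/orP: altE => ?; [exists false | exists true].
have [|red_s parse_s hs] := @alt_parseK e 1 E _ pathE altE.
  by apply/is_alt_termP; left.
rewrite invg1 /= in red_s; rewrite -(free_prod (Free red_s)) in wE.
rewrite wE /= -[LHS]parse_s; move: (hs erefl).
by case: (letters E) => [|l s] // /eqP->.
Qed.

(* The number of pairs in the alternating pairs expression of w. *)
Definition alt_norm w : nat := size (xchoose (alt_expr_exists w)).

Lemma alt_normE w E : is_alt_expr w E -> alt_norm w = size E.
Proof. by move/(alt_expr_unique (xchooseP (alt_expr_exists w)))<-. Qed.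

End AlternatingNorm.

Section Reduction.
Variable T : finType.
Implicit Types (f : {perm T}) (s : seq (T * bool)) (w : free_group T).

(* Cancels the first letter l of a word with its last letter when the latter
   is the inverse of f(l); acts as the identity on other words. *)
Definition kcancel f s :=
  if s is l :: l1 :: s1 then
    if last l1 s1 == linv (f l.1, l.2) then belast l1 s1 else s
  else s.

Lemma kcancel_reduced f s : reduced s -> reduced (kcancel f s).
Proof.
case: s => [|l [|l1 s1]] // red_s /=; case: ifP => // _.
by move: (reduced_tail red_s); rewrite lastI -cats1 => /cat_sorted2[].
Qed.

Lemma iter_kcancel_reduced f n s :
  reduced s -> reduced (iter n (kcancel f) s).
Proof. by move=> red_s; elim: n => //= n; apply: kcancel_reduced. Qed.

(* Each cancellation removes two letters, so size w steps reach the fixpoint. *)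
Definition kred f w : free_group T :=
  Free (iter_kcancel_reduced f (size w) (word_reduced w)).

Lemma kred_stable f w : kcancel f (kred f w) = kred f w.
Proof.
case: w => s red_s /=; have [n] := ubnPleq (size s).
elim: n s {red_s} => [|n IHn] s le_s; first by case: s le_s.
have [e|ne] := eqVneq (kcancel f s) s.
  by have it m : iter m (kcancel f) s = s; [elim: m => //= m -> | rewrite it].
rewrite iterSr; apply: IHn.
move: ne le_s; case: s => [|l [|l1 s1]] /=; rewrite ?eqxx //.
by case: ifP => _; rewrite ?eqxx // size_belast => _ /ltnW.
Qed.

Definition kalt_norm f w : nat := alt_norm (kred f w).

End Reduction.

Local Open Scope ring_scope.

Section Quaternion.
Variable R : realFieldType.

Record quaternion := Quat { qre : R; qim1 : R; qim2 : R; qim3 : R }.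

Implicit Types x y z : quaternion.

Let tuple_of_quat x := (qre x, qim1 x, qim2 x, qim3 x).
Let quat_of_tuple (t : R * R * R * R) :=
  let: (a, b, c, d) := t in Quat a b c d.

Fact tuple_of_quatK : cancel tuple_of_quat quat_of_tuple.
Proof. by case. Qed.

HB.instance Definition _ := Equality.copy quaternion (can_type tuple_of_quatK).
HB.instance Definition _ := Choice.copy quaternion (can_type tuple_of_quatK).

Definition qadd x y := Quat (qre x + qre y) (qim1 x + qim1 y)
  (qim2 x + qim2 y) (qim3 x + qim3 y).
Definition qopp x := Quat (- qre x) (- qim1 x) (- qim2 x) (- qim3 x).

Fact qaddA : associative qadd.
Proof. by move=> x y z; rewrite /qadd /= !addrA. Qed.
Fact qaddC : commutative qadd.
Proof.
by move=> x y; congr Quat; rewrite addrC.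
Qed.
Fact qadd0 : left_id (Quat 0 0 0 0) qadd.
Proof. by case=> a b c d; rewrite /qadd /= !add0r. Qed.
Fact qaddN : left_inverse (Quat 0 0 0 0) qopp qadd.
Proof. by case=> a b c d; rewrite /qadd /= !addNr. Qed.

HB.instance Definition _ := GRing.isZmodule.Build quaternion qaddA qaddC qadd0 qaddN.

Definition qmul x y :=
  let: Quat a1 b1 c1 d1 := x in
  let: Quat a2 b2 c2 d2 := y in
  Quat (a1 * a2 - b1 * b2 - c1 * c2 - d1 * d2)
       (a1 * b2 + b1 * a2 + c1 * d2 - d1 * c2)
       (a1 * c2 - b1 * d2 + c1 * a2 + d1 * b2)
       (a1 * d2 + b1 * c2 - c1 * b2 + d1 * a2).

Fact qmulA : associative qmul.
Proof. by case=> ? ? ? ? [? ? ? ?] [? ? ? ?]; congr Quat; ring. Qed.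
Fact qmul1q : left_id (Quat 1 0 0 0) qmul.
Proof. by case=> ? ? ? ?; congr Quat; ring. Qed.
Fact qmulq1 : right_id (Quat 1 0 0 0) qmul.
Proof. by case=> ? ? ? ?; congr Quat; ring. Qed.
Fact qmulDl : left_distributive qmul qadd.
Proof. by case=> ? ? ? ? [? ? ? ?] [? ? ? ?]; congr Quat => /=; ring. Qed.
Fact qmulDr : right_distributive qmul qadd.
Proof. by case=> ? ? ? ? [? ? ? ?] [? ? ? ?]; congr Quat => /=; ring. Qed.
Fact qone_neq0 : Quat 1 0 0 0 != 0.
Proof. by apply/eqP => -[] /eqP; rewrite oner_eq0. Qed.

HB.instance Definition _ := GRing.Zmodule_isNzRing.Build quaternion
  qmulA qmul1q qmulq1 qmulDl qmulDr qone_neq0.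

Definition qnorm2 x := qre x ^+ 2 + qim1 x ^+ 2 + qim2 x ^+ 2 + qim3 x ^+ 2.

Definition qinv x := Quat (qre x / qnorm2 x) (- qim1 x / qnorm2 x)
  (- qim2 x / qnorm2 x) (- qim3 x / qnorm2 x).

Lemma qnorm2_eq0 x : (qnorm2 x == 0) = (x == 0).
Proof.
apply/idP/eqP => [|->]; last by rewrite /qnorm2 /= !expr0n /= !addr0.
case: x => a b c d; rewrite /qnorm2 /= !paddr_eq0 ?addr_ge0 ?sqr_ge0 //.
by rewrite !sqrf_eq0 => /andP[/andP[/andP[/eqP-> /eqP->] /eqP->] /eqP->].
Qed.

Fact qmulVq : {in [pred x | x != 0], left_inverse 1 qinv *%R}.
Proof.
move=> x; rewrite inE -qnorm2_eq0; case: x => a b c d nx.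
by congr Quat; rewrite /= /qnorm2 /= in nx *; field.
Qed.

Fact qmulqV : {in [pred x | x != 0], right_inverse 1 qinv *%R}.
Proof.
move=> x; rewrite inE -qnorm2_eq0; case: x => a b c d nx.
by congr Quat; rewrite /= /qnorm2 /= in nx *; field.
Qed.

Fact qunitP x y : y * x = 1 /\ x * y = 1 -> x != 0.
Proof.
by case=> + _; apply: contra_eq_neq => ->; rewrite mulr0 eq_sym oner_eq0.
Qed.

Fact qinv_out : {in [predC [pred x | x != 0]], qinv =1 id}.
Proof.
move=> x /negPn/eqP->.
by rewrite /qinv /= oppr0 mul0r.
Qed.

HB.instance Definition _ := GRing.NzRing_hasMulInverse.Build quaternion
  qmulVq qmulqV qunitP qinv_out.

Lemma qunitE x : (x \is a GRing.unit) = (x != 0).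
Proof. by []. Qed.

Definition qcoord x (k : 'I_4) : R :=
  nth 0 [:: qre x; qim1 x; qim2 x; qim3 x] k.

(* qbasis 0 = 1, and qbasis 1, 2, 3 are Hamilton's i, j, k. *)
Definition qbasis (k : 'I_4) : quaternion :=
  Quat (k == 0 :> nat)%:R (k == 1 :> nat)%:R (k == 2 :> nat)%:R
       (k == 3 :> nat)%:R.

End Quaternion.

Section UniversalProperty.
Variables (T : finType) (A : unitRingType) (f : T -> A).

(* The homomorphism from the free group to the units of A extending f. *)
Definition free_lift (w : free_group T) : A :=
  \prod_(l <- word w) if l.2 then (f l.1)^-1 else f l.1.

Lemma free_lift_gen t : free_lift (free_gen t) = f t.
Proof. by rewrite /free_lift big_seq1. Qed.

Hypothesis Uf : forall t, f t \is a GRing.unit.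

Lemma free_lift_unit w : free_lift w \is a GRing.unit.
Proof.
rewrite /free_lift; elim/big_ind: _ => [|x y Ux Uy|l _]; rewrite ?unitr1 //.
  by rewrite unitrMl.
by case: ifP; rewrite ?unitrV.
Qed.

Lemma free_liftM u v : free_lift (u * v)%g = free_lift u * free_lift v.
Proof.
rewrite /free_lift /=; case: u => s red_s /=; elim: s {red_s} => [|l s IHs] /=.
  by rewrite big_nil mul1r.
rewrite big_cons -mulrA -IHs; case: (wmul s v) => [|l' s'] /=.
  by rewrite big_seq1 big_nil mulr1.
rewrite big_cons; case: eqP => [->|_] /=; last by rewrite !big_cons.
by case: l.2; rewrite /= ?mulKr ?mulVKr.
Qed.

Lemma free_lift1 : free_lift 1%g = 1.
Proof. exact: big_nil. Qed.

End UniversalProperty.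

Section Simplex.

(* The generators g_1, ..., g_4 and the vertices q_1, ..., q_4 are indexed by
   0, ..., 3 : 'I_4. *)
Definition simplex (R : realType) (i : 'I_4) : quaternion R :=
  let s := Num.sqrt 5 / 4 in
  tnth [tuple Quat (- 1 / 4) s s s; Quat (- 1 / 4) (- s) (- s) s;
              Quat (- 1 / 4) s (- s) (- s); Quat (- 1 / 4) (- s) s (- s)] i.

Definition simplex_perm (k : 'I_4) : {perm 'I_4} :=
  let i1 : 'I_4 := 0 in let i2 : 'I_4 := 1 in
  let i3 : 'I_4 := 2 in let i4 : 'I_4 := 3 in
  tnth [tuple 1; tperm i1 i3 * tperm i2 i4; tperm i1 i4 * tperm i2 i3;
              tperm i1 i2 * tperm i3 i4]%g k.

Lemma simplex_unit (R : realType) i : simplex R i \is a GRing.unit.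
Proof.
have n14 : (-1 / 4 : R) != 0 by rewrite mulf_neq0 ?invr_neq0 ?pnatr_eq0 ?oppr_eq0 ?oner_eq0.
rewrite qunitE; apply: contra_neq n14 => x0.
rewrite -[RHS]/(qre (0 : quaternion R)) -x0.
by case: i {x0} => -[|[|[|[|//]]]] lti; rewrite /simplex (tnth_nth 0).
Qed.

Lemma simplex_permE (R : realType) (k i : 'I_4) :
  qbasis R k * simplex R i / qbasis R k = simplex R (simplex_perm k i).
Proof.
have Uk : qbasis R k \is a GRing.unit.
  rewrite qunitE; apply/eqP => /(congr1 (@qcoord R ^~ k))/eqP.
  by case: k => -[|[|[|[|//]]]] ltk; rewrite /qcoord /= oner_eq0.
apply: (canLR (mulrK Uk)); case: k {Uk} => -[|[|[|[|//]]]] ltk;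
  case: i => -[|[|[|[|//]]]] lti; rewrite /simplex_perm [tnth _ (Ordinal ltk)](tnth_nth 1%g) /= ?permM !permE /= /simplex !(tnth_nth 0) /=;
  by congr Quat => /=; ring.
Qed.

Definition rho (R : realType) : free_group 'I_4 -> quaternion R :=
  free_lift (simplex R).

End Simplex.

Section AlgebraicDenominator.
Variable R : realType.
Implicit Types x y : R.

Definition alg_int y : Prop := integralOver (intr : int -> R) y.

Definition odd_alg_int y : Prop := alg_int y /\ ~ alg_int (y / 2).

Definition has_lad x (m : int) : Prop :=
  exists2 y, odd_alg_int y & x = y / 2 ^ (m + 1).

(* The notion is partial: +oo stands for "undefined", at the reals that are
   neither 0 nor of the form y / 2 ^ (m + 1) with y odd. *)
Definition lad x : \bar int :=
  if x == 0 then -oo%E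
  else xget +oo%E [set e | exists2 m, has_lad x m & e = m%:E].

Lemma has_lad_inj x m n : has_lad x m -> has_lad x n -> m = n.
Proof.
wlog le_mn : m n / m <= n => [hw xm xn|].
  by case: (leP m n) => [|/ltW] /hw; [apply | move=> ->].
case=> y [int_y _] xy [z [_ odd_z] xz].
apply/eqP; rewrite eq_le le_mn leNgt; apply/negP => lt_mn; apply: odd_z.
have n2 : (2 : R) != 0 by rewrite pnatr_eq0.
have [k nE] : exists k : nat, n = m + 1 + k%:Z.
  by exists `|(n - (m + 1))%R|%N; rewrite gez0_abs ?subr_ge0 ?lezD1 // addrC subrK.
have zE : z = y * 2 ^+ k * 2.
  rewrite -[LHS](divfK (expfz_neq0 (n + 1) n2)) -xz xy nE -addrA (expfzDr (m + 1)) //.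
  by rewrite mulrA divfK ?expfz_neq0 // expfzDr // mulrA.
rewrite /alg_int zE mulfK // -natrX.
by apply: integral_mul => //; apply: integral_nat.
Qed.

Lemma has_lad_neq0 x m : has_lad x m -> x != 0.
Proof.
case=> y [_ odd_y] ->; rewrite mulf_neq0 ?invr_eq0 ?expfz_neq0 ?pnatr_eq0 //.
by apply/eqP => y0; apply: odd_y; rewrite y0 mul0r; apply: integral0.
Qed.

Lemma ladP x m : lad x = m%:E <-> has_lad x m.
Proof.
rewrite /lad; split=> [|xm].
  by case: eqP => // _; case: xgetP => // e -> [n xn ->] [<-].
rewrite (negPf (has_lad_neq0 xm)).
by case: xgetP => [e -> [n xn ->]|/(_ m%:E)[]]; [rewrite (has_lad_inj xn xm) | exists m].
Qed.

End AlgebraicDenominator.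

(* Main.v *)
(* The quaternions 1, q_1, ..., q_4 are the vertices of a regular simplex.
   Multiplied on the right by 1 + i_1, of norm 2, they become elements s_0,
   ..., s_4 of an icosian order over Z[phi], phi the golden ratio. The prime
   2 is inert in Z[phi], and the icosians modulo 2 are the 2 x 2 matrices
   over F_4. Each s_a reduces to a matrix of rank one, and the five images,
   as well as the five kernels, are pairwise distinct points of the
   projective line over F_4. As s_a times the conjugate of s_b is 2 q_a
   q_b^-1 (with q_0 = 1), an alternating product of n pairs, multiplied by
   2^n, reduces to a nonzero matrix of rank one whose image is the image of
   the first s_a and whose kernel is the image of the last s_b. Left
   multiplication by i_k permutes the images of the s_a by the permutation
   pi_k, so for a k-reduced word the trace of this matrix times the reduction
   of i_k is nonzero. This says that 2^(n+1) x_k is odd. The words that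
   alternate with inverses of generators are treated by the Galois
   conjugation of Z[phi], which maps each q_i to its inverse. *)
From HB Require Import structures.
Require Import Defs.
From mathcomp Require Import all_boot all_order all_algebra.
From mathcomp Require Import all_fingroup.
From mathcomp Require Import ring zify.
From mathcomp Require Import boolp reals constructive_ereal.

Set Implicit Arguments.
Unset Strict Implicit.
Unset Printing Implicit Defensive.

Import Order.TTheory GRing.Theory Num.Theory.
Local Open Scope ring_scope.

(** * The field with four elements *)

(* F4_f is a root of X^2 + X + 1 and F4_g = F4_f + 1. *)
Variant F4 := F4_0 | F4_1 | F4_f | F4_g.

Definition F4_code c : bool * bool :=
  match c with
  | F4_0 => (false, false) | F4_1 => (true, false)
  | F4_f => (false, true) | F4_g => (true, true)
  end.

Definition F4_decode (c : bool * bool) : F4 :=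
  match c with
  | (false, false) => F4_0 | (true, false) => F4_1
  | (false, true) => F4_f | (true, true) => F4_g
  end.

Fact F4_codeK : cancel F4_code F4_decode. Proof. by case. Qed.

HB.instance Definition _ := Equality.copy F4 (can_type F4_codeK).
HB.instance Definition _ := Choice.copy F4 (can_type F4_codeK).

Definition F4_add c d :=
  let: (a, b) := F4_code c in let: (a', b') := F4_code d in
  F4_decode (a (+) a', b (+) b').
Definition F4_mul c d :=
  let: (a, b) := F4_code c in let: (a', b') := F4_code d in
  F4_decode ((a && a') (+) (b && b'), (a && b') (+) (b && a') (+) (b && b')).

Fact F4_addA : associative F4_add. Proof. by do 3 case. Qed.
Fact F4_addC : commutative F4_add. Proof. by do 2 case. Qed.
Fact F4_add0 : left_id F4_0 F4_add. Proof. by case. Qed.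
Fact F4_addN : left_inverse F4_0 id F4_add. Proof. by case. Qed.
HB.instance Definition _ := GRing.isZmodule.Build F4
  F4_addA F4_addC F4_add0 F4_addN.

Fact F4_mulA : associative F4_mul. Proof. by do 3 case. Qed.
Fact F4_mulC : commutative F4_mul. Proof. by do 2 case. Qed.
Fact F4_mul1 : left_id F4_1 F4_mul. Proof. by case. Qed.
Fact F4_mulDl : left_distributive F4_mul F4_add. Proof. by do 3 case. Qed.
Fact F4_1_neq0 : F4_1 != 0. Proof. by []. Qed.
HB.instance Definition _ := GRing.Zmodule_isComNzRing.Build F4
  F4_mulA F4_mulC F4_mul1 F4_mulDl F4_1_neq0.

Lemma F4_f_sqr : F4_f ^+ 2 = F4_f - 1. Proof. by []. Qed.

Lemma F4_mulf_neq0 (c d : F4) : c != 0 -> d != 0 -> c * d != 0.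
Proof. by case: c; case: d. Qed.

Lemma F4_nat n : n%:R = (odd n)%:R :> F4.
Proof. by elim: n => //= n IHn; rewrite -natr1 IHn; case: (odd n). Qed.

Lemma F4_int (a : int) : a%:~R = (odd `|a|%N)%:R :> F4.
Proof.
case: a => n; first exact: F4_nat.
by rewrite -[LHS]/(- (n.+1%:R)) (F4_nat n.+1) /=; case: (odd n).
Qed.

Lemma F4_basis (c : F4) : exists a b : int, c = a%:~R + b%:~R * F4_f.
Proof. by case: c; [exists 0, 0 | exists 1, 0 | exists 0, 1 | exists 1, 1]. Qed.

Lemma F4_inv (c : F4) : c != 0 -> exists d, d * c = 1.
Proof. by case: c => // _; [exists F4_1 | exists F4_g | exists F4_f]. Qed.

Lemma F4_int_odd (m : nat) : odd m -> (m : int)%:~R = 1 :> F4.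
Proof. by move=> odd_m; rewrite F4_int /= odd_m. Qed.

(** Since 1 and [F4_f] are independent over F_2, the parities of [a] and [b] can be read off. *)
Lemma F4_eq1 (a b : int) : a%:~R + b%:~R * F4_f = 1 ->
  exists a' b' : int, a = 1 + 2 * a' /\ b = 2 * b'.
Proof.
rewrite !F4_int; case: (boolP (odd `|a|)); case: (boolP (odd `|b|)) => // ? ? _.
by exists ((a - 1) %/ 2)%Z, (b %/ 2)%Z; lia.
Qed.

(** * Quaternion conjugation *)

Section QuaternionConjugation.
Variable R : realFieldType.

Definition qconj (x : quaternion R) := Quat (qre x) (- qim1 x) (- qim2 x) (- qim3 x).

Lemma qconjM (x y : quaternion R) : qconj (x * y) = qconj y * qconj x.
Proof. by case: x => a b c d; case: y => *; congr Quat => /=; ring. Qed.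

Lemma qmul_conj (x : quaternion R) : x * qconj x = Quat (qnorm2 x) 0 0 0.
Proof. by case: x => a b c d; congr Quat; rewrite /qnorm2 /=; ring. Qed.

Lemma qmul1_inv (x y : quaternion R) : x * y = 1 -> y = x^-1.
Proof.
move=> xy1; have Ux : x \is a GRing.unit.
  by rewrite qunitE; apply: contra_eq_neq xy1 => ->; rewrite mul0r eq_sym oner_eq0.
by apply: (mulrI Ux); rewrite xy1 mulrV.
Qed.

Lemma qre_comm (x y : quaternion R) : qre (x * y) = qre (y * x).
Proof. by case: x => a b c d; case: y => a' b' c' d' /=; ring. Qed.

(** As a real part, a coordinate is half a reduced trace: it can be computed modulo 2 and is
    invariant under conjugation. *)
Lemma qcoordE (x : quaternion R) k : qcoord x k = qre (x * qconj (qbasis R k)).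
Proof.
by case: x => a b c d; case: k => -[|[|[|[|//]]]] ?; rewrite /qcoord /=; ring.
Qed.

Lemma qre_natl n (x : quaternion R) : qre (n%:R * x) = n%:R * qre x.
Proof.
elim: n => [|n IHn]; first by rewrite !mul0r.
by rewrite -!natr1 !mulrDl !mul1r -IHn.
Qed.

Lemma qbasis_conj k : qbasis R k * qconj (qbasis R k) = 1.
Proof.
by rewrite qmul_conj; congr Quat; case: k => -[|[|[|[|//]]]] ?; rewrite /qnorm2 /=; ring.
Qed.

Lemma qbasis_conjl k : qconj (qbasis R k) * qbasis R k = 1.
Proof.
by case: k => -[|[|[|[|//]]]] ?; congr Quat; rewrite /=; ring.
Qed.

Lemma qbasis_swap k (x : quaternion R) :
  qbasis R k * x * qconj (qbasis R k) = qconj (qbasis R k) * x * qbasis R k.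
Proof.
by case: x => a b c d; case: k => -[|[|[|[|//]]]] ?; congr Quat => /=; ring.
Qed.

End QuaternionConjugation.

(** * Reduction of the icosians modulo 2 *)

Section ReductionModTwo.
Variables (R : realFieldType) (phi : R).
Hypothesis phi_sqr : phi ^+ 2 = phi + 1.
Implicit Types (r : R) (c : F4) (x y : quaternion R) (A B : 'M[F4]_2).

(* r lies in the localization of Z[phi] at 2 and reduces to c. *)
Definition zred r c := exists (m : nat) (a b : int),
  [/\ odd m, m%:R * r = a%:~R + b%:~R * phi & c = a%:~R + b%:~R * F4_f].

Lemma zred_frac (a b : int) (m : nat) : odd m ->
  zred ((a%:~R + b%:~R * phi) / m%:R) (a%:~R + b%:~R * F4_f).
Proof.
move=> odd_m; exists m, a, b; split=> //.
by rewrite mulrC divfK // pnatr_eq0; case: m odd_m.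
Qed.

Lemma zredD r1 r2 c1 c2 : zred r1 c1 -> zred r2 c2 -> zred (r1 + r2) (c1 + c2).
Proof.
case=> m1 [a1 [b1 [odd1 r1E ->]]] [m2 [a2 [b2 [odd2 r2E ->]]]].
exists (m1 * m2)%N, (a1 * m2 + a2 * m1), (b1 * m2 + b2 * m1).
split; first by rewrite oddM odd1.
  rewrite natrM !rmorphD !rmorphM /=.
  rewrite (_ : _ * _ = m2%:R * (m1%:R * r1) + m1%:R * (m2%:R * r2)); last by ring.
  by rewrite r1E r2E; ring.
rewrite !rmorphD !rmorphM /= !F4_int_odd //; ring.
Qed.

Lemma zredN r c : zred r c -> zred (- r) (- c).
Proof.
case=> m [a [b [odd_m rE ->]]]; exists m, (- a), (- b); split=> //.
  by rewrite mulrN rE !rmorphN; ring.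
by rewrite !rmorphN; ring.
Qed.

Lemma zredB r1 r2 c1 c2 : zred r1 c1 -> zred r2 c2 -> zred (r1 - r2) (c1 - c2).
Proof. by move=> h1 /zredN; apply: zredD. Qed.

Lemma zredM r1 r2 c1 c2 : zred r1 c1 -> zred r2 c2 -> zred (r1 * r2) (c1 * c2).
Proof.
case=> m1 [a1 [b1 [odd1 r1E ->]]] [m2 [a2 [b2 [odd2 r2E ->]]]].
exists (m1 * m2)%N, (a1 * a2 + b1 * b2), (a1 * b2 + b1 * a2 + b1 * b2).
split; first by rewrite oddM odd1.
  rewrite natrM mulrACA r1E r2E !rmorphD !rmorphM /=.
  by ring: phi_sqr.
have f_sqr : F4_f ^+ 2 = F4_f + 1 by [].
rewrite !rmorphD !rmorphM /=.
by ring: f_sqr.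
Qed.

(* a0 + a1 theta + (b0 + b1 theta) e, where theta = (1 + i + j + k) / 2 and
   e = (i + (phi - 1) j - phi k) / 2 satisfy theta^2 = theta - 1, e^2 = -1 and
   e theta = (1 - theta) e. These elements span an order over Z[phi] of odd
   index in the icosians, hence the localization in zred. *)
Definition qcomb (a0 a1 b0 b1 : R) : quaternion R :=
  Quat (a0 + a1 / 2) ((a1 + b0 + b1 * (1 - phi)) / 2)
    ((a1 + b0 * (phi - 1) + b1 * phi) / 2) ((a1 - b0 * phi - b1) / 2).

(* The image of a0 + a1 theta + (b0 + b1 theta) e under the representation
   theta |-> diag(f, 1 - f), e |-> [[0, 1], [-1, 0]]. *)
Definition mcomb (a0 a1 b0 b1 : F4) : 'M[F4]_2 :=
  \matrix_(i, j) if i == 0 then if j == 0 then a0 + a1 * F4_f else b0 + b1 * F4_f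
    else if j == 0 then - (b0 + b1 - b1 * F4_f) else a0 + a1 - a1 * F4_f.

(** The same polynomials occur in [mcombM] over F_4, which makes reduction multiplicative. *)
Lemma qcombM (a0 a1 b0 b1 c0 c1 d0 d1 : R) :
  qcomb a0 a1 b0 b1 * qcomb c0 c1 d0 d1 =
  qcomb (a0 * c0 - a1 * c1 - (b0 * d0 + b0 * d1 + b1 * d1))
        (a0 * c1 + a1 * c0 + a1 * c1 - (b1 * d0 - b0 * d1))
        (a0 * d0 - a1 * d1 + b0 * c0 + b0 * c1 + b1 * c1)
        (a0 * d1 + a1 * d0 + a1 * d1 + b1 * c0 - b0 * c1).
Proof.
by congr Quat; field: phi_sqr.
Qed.

Lemma mcombM (a0 a1 b0 b1 c0 c1 d0 d1 : F4) :
  mcomb a0 a1 b0 b1 *m mcomb c0 c1 d0 d1 =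
  mcomb (a0 * c0 - a1 * c1 - (b0 * d0 + b0 * d1 + b1 * d1))
        (a0 * c1 + a1 * c0 + a1 * c1 - (b1 * d0 - b0 * d1))
        (a0 * d0 - a1 * d1 + b0 * c0 + b0 * c1 + b1 * c1)
        (a0 * d1 + a1 * d0 + a1 * d1 + b1 * c0 - b0 * c1).
Proof.
apply/matrixP => i j; rewrite !mxE big_ord_recl big_ord1 !mxE /=.
have f_sqr := F4_f_sqr.
case: i => -[|[|//]] ?; case: j => -[|[|//]] ? /=.
all: by ring: f_sqr.
Qed.

Definition zpair (z : R * F4) := zred z.1 z.2.

Definition qred x A := exists a0 a1 b0 b1 : R * F4,
  [/\ zpair a0, zpair a1, zpair b0 & zpair b1] /\
  (x = qcomb a0.1 a1.1 b0.1 b1.1 /\ A = mcomb a0.2 a1.2 b0.2 b1.2).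

Lemma qredM x y A B : qred x A -> qred y B -> qred (x * y) (A *m B).
Proof.
case=> a0 [a1] [b0] [b1] [[ha0 ha1 hb0 hb1] [-> ->]].
case=> c0 [c1] [d0] [d1] [[hc0 hc1 hd0 hd1] [-> ->]].
rewrite qcombM mcombM; do 4 eexists (_, _); split; last by split; reflexivity.
by split; rewrite /zpair /=; repeat (apply: zredB || apply: zredD || apply: zredM).
Qed.

Lemma qconj_comb (a0 a1 b0 b1 : R) :
  qconj (qcomb a0 a1 b0 b1) = qcomb (a0 + a1) (- a1) (- b0) (- b1).
Proof. by congr Quat => /=; field. Qed.

(* For 2 x 2 matrices, (\tr A)%:M - A is the adjugate of A. *)
Lemma mcomb_adj (a0 a1 b0 b1 : F4) :
  mcomb (a0 + a1) (- a1) (- b0) (- b1) =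
  (\tr (mcomb a0 a1 b0 b1))%:M - mcomb a0 a1 b0 b1.
Proof.
rewrite /mxtrace big_ord_recl big_ord1.
apply/matrixP => i j; rewrite !mxE /= ?mulr1n ?mulr0n.
case: i => -[|[|//]] ?; case: j => -[|[|//]] ? /=; rewrite ?mulr1n ?mulr0n.
all: by ring.
Qed.

Lemma qred_conj x A : qred x A -> qred (qconj x) ((\tr A)%:M - A).
Proof.
case=> a0 [a1] [b0] [b1] [[ha0 ha1 hb0 hb1] [-> ->]].
rewrite qconj_comb -mcomb_adj; do 4 eexists (_, _); split; last by split; reflexivity.
by split; rewrite /zpair /=; repeat (apply: zredN || apply: zredD).
Qed.

Lemma qred_trace x A : qred x A -> zred (2 * qre x) (\tr A).
Proof.
case=> a0 [a1] [b0] [b1] [[ha0 ha1 _ _] [-> ->]].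
rewrite /mxtrace big_ord_recl big_ord1 !mxE /=.
rewrite (_ : 2 * _ = a0.1 + a0.1 + a1.1); last by field.
rewrite [X in zred _ X](_ : _ = a0.2 + a0.2 + a1.2); last by ring.
by do 2 apply: zredD => //.
Qed.

End ReductionModTwo.

(** * The simplex vertices and the basis units modulo 2 *)

Section Vertices.
Variables (R : realFieldType) (phi : R).
Hypothesis phi_sqr : phi ^+ 2 = phi + 1.

(* For phi = (1 + sqrt 5) / 2 the vertices of the simplex, with None for 1; for
   the conjugate phi = (1 - sqrt 5) / 2 their inverses. *)
Definition vertex_at (a : option 'I_4) : quaternion R :=
  let s := (2 * phi - 1) / 4 in
  if a is Some i then
    tnth [tuple Quat (- 1 / 4) s s s; Quat (- 1 / 4) (- s) (- s) s;
                Quat (- 1 / 4) s (- s) (- s); Quat (- 1 / 4) (- s) s (- s)] i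
  else 1.

Definition cvec (u : F4 * F4) : 'cV[F4]_2 := \col_i if i == 0 then u.1 else u.2.
Definition rvec (u : F4 * F4) : 'rV[F4]_2 := \row_i if i == 0 then u.1 else u.2.
Definition perp (u : F4 * F4) : F4 * F4 := (u.2, - u.1).

(* img and coimg are the rank one decomposition of the reduction of
   vertex_at a * (1 + i_1): see qred_vertex. *)
Definition img (a : option 'I_4) : F4 * F4 :=
  if a is Some i then
    tnth [tuple (F4_0, F4_1); (F4_f, F4_1); (F4_1, F4_1); (F4_g, F4_1)] i
  else (F4_1, F4_0).

Definition coimg (a : option 'I_4) : F4 * F4 :=
  if a is Some i then
    tnth [tuple (F4_1, F4_f); (F4_1, F4_1); (F4_1, F4_g); (F4_1, F4_0)] i
  else (F4_0, F4_1).

(* The reduction of qbasis k; on the affine line {(z, 1)} it is a translation. *)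
Definition unit_shift (k : 'I_4) : 'M[F4]_2 :=
  \matrix_(i, j) if (i == 0) && (j == 1) then
    tnth [tuple F4_0; F4_1; F4_g; F4_f] k else (i == j)%:R.

Lemma rvec_cvec u v : rvec u *m cvec v = (u.1 * v.1 + u.2 * v.2)%:M.
Proof.
apply/matrixP => i j; rewrite !ord1 !mxE big_ord_recl big_ord1 !mxE /=.
by rewrite mulr1n.
Qed.

(** The adjugate of a rank one matrix exchanges image and kernel. *)
Lemma outer_adj u v :
  (\tr (cvec u *m rvec v))%:M - cvec u *m rvec v = cvec (perp v) *m rvec (perp u).
Proof.
rewrite /mxtrace big_ord_recl big_ord1.
apply/matrixP => i j; rewrite !mxE !big_ord1 !mxE /=.
case: i => -[|[|//]] ?; case: j => -[|[|//]] ? /=; rewrite ?mulr1n ?mulr0n.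
all: by ring.
Qed.

(** The pairing of [rvec (perp u)] with [cvec v]; it vanishes when [u] and [v] are proportional. *)
Definition det2 (u v : F4 * F4) := u.2 * v.1 - u.1 * v.2.

Lemma img_det a b : a != b -> det2 (img a) (img b) != 0.
Proof.
by case: a => [[[|[|[|[|//]]]] ?]|]; case: b => [[[|[|[|[|//]]]] ?]|].
Qed.

Lemma coimg_det a b : a != b -> det2 (coimg a) (coimg b) != 0.
Proof.
by case: a => [[[|[|[|[|//]]]] ?]|]; case: b => [[[|[|[|[|//]]]] ?]|].
Qed.

Lemma unit_shift_img k a :
  unit_shift k *m cvec (img a) = cvec (img (omap (simplex_perm k) a)).
Proof.
apply/colP => i; rewrite !mxE big_ord_recl big_ord1 !mxE /=.
case: k => -[|[|[|[|//]]]] ltk; case: a => [[[|[|[|[|//]]]] lta]|];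
 rewrite /simplex_perm ?[tnth _ (Ordinal ltk)](tnth_nth 1%g) /= ?permM ?permE /= ?permE /=.
all: by case: i => -[|[|//]].
Qed.

(** The denominator 3 is odd and reduces to 1, so the numerators alone determine the matrix. *)
Lemma qred_third (a0 a0' a1 a1' b0 b0' b1 b1' : int) :
  qred phi (qcomb phi ((a0%:~R + a0'%:~R * phi) / 3) ((a1%:~R + a1'%:~R * phi) / 3)
                  ((b0%:~R + b0'%:~R * phi) / 3) ((b1%:~R + b1'%:~R * phi) / 3))
         (mcomb (a0%:~R + a0'%:~R * F4_f) (a1%:~R + a1'%:~R * F4_f)
                (b0%:~R + b0'%:~R * F4_f) (b1%:~R + b1'%:~R * F4_f)).
Proof.
by do 4 eexists (_, _); split; last (split; reflexivity); split; apply: zred_frac.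
Qed.

Lemma qred_vertex a :
  qred phi (vertex_at a * Quat 1 1 0 0) (cvec (img a) *m rvec (coimg a)).
Proof.
(* Row a lists the numerators over 3 of the coordinates of
   vertex_at a * (1 + i_1), each coefficient u + v phi as u; v. *)
pose t := [:: [:: 2; 0; 2; 0; 1; 1; 1; - 2];
           [:: 1; - 3; - 2; 3; 2; - 1; - 1; 2];
           [:: - 1; 1; - 1; 1; - 3; - 1; 3; - 1];
           [:: 0; - 1; 0; - 1; - 2; 2; - 2; - 1];
           [:: - 2; 3; 1; - 3; 2; - 1; - 1; 2]] : seq (seq int).
pose n := if a is Some i then i.+1 : nat else 0%N.
pose c j := nth 0 (nth [::] t n) j.
have := qred_third (c 0) (c 1) (c 2) (c 3) (c 4) (c 5) (c 6) (c 7).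
congr (qred phi); last first.
  apply/matrixP => i j; rewrite !mxE big_ord1 !mxE.
  by move: @n @c; case: a => [[[|[|[|[|//]]]] ?]|];
    case: i => -[|[|//]] ?; case: j => -[|[|//]] ? /=.
move: @n @c; case: a => [[[|[|[|[|//]]]] ?]|] /=; rewrite /vertex_at ?(tnth_nth 0) /=.
all: by congr Quat => /=; field: phi_sqr.
Qed.

(** Conjugation changes [qbasis R k] at most by a sign, which is lost modulo 2. The rows of [t] are
    numerators over 3, as in [qred_vertex]. *)
Lemma qred_qbasis (k : 'I_4) : qred phi (qconj (qbasis R k)) (unit_shift k).
Proof.
pose t := [:: [:: 3; 0; 0; 0; 0; 0; 0; 0];
           [:: 1; 0; - 2; 0; - 1; - 1; - 1; 2];
           [:: 1; 0; - 2; 0; 2; - 1; - 1; - 1];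
           [:: 1; 0; - 2; 0; - 1; 2; 2; - 1]] : seq (seq int).
pose c j := nth 0 (nth [::] t k) j.
have := qred_third (c 0) (c 1) (c 2) (c 3) (c 4) (c 5) (c 6) (c 7).
congr (qred phi); last first.
  apply/matrixP => i j; rewrite !mxE.
  by move: @c; case: k => -[|[|[|[|//]]]] ?;
    case: i => -[|[|//]] ?; case: j => -[|[|//]] ? /=.
move: @c; case: k => -[|[|[|[|//]]]] ? /=.
all: by congr Quat => /=; field: phi_sqr.
Qed.

End Vertices.

(** * Alternating products of vertices *)

Section AlternatingProduct.
Variables (R : realFieldType) (phi : R).
Hypothesis phi_sqr : phi ^+ 2 = phi + 1.

Lemma vertex_at_conj a : vertex_at phi a * qconj (vertex_at phi a) = 1.
Proof.
rewrite qmul_conj; congr Quat; case: a => [[[|[|[|[|//]]]] ?]|];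
  rewrite /qnorm2 /vertex_at ?(tnth_nth 0) /=; by field: phi_sqr.
Qed.

Lemma qred_pair a b :
  qred phi (2 * (vertex_at phi a * (vertex_at phi b)^-1))
    (det2 (coimg b) (coimg a) *: (cvec (img a) *m rvec (perp (img b)))).
Proof.
pose t : quaternion R := Quat 1 1 0 0.
have -> : 2 * (vertex_at phi a * (vertex_at phi b)^-1) =
    vertex_at phi a * t * qconj (vertex_at phi b * t).
  rewrite qconjM -mulrA (mulrA t) (_ : t * qconj t = 2); last first.
    by rewrite qmul_conj; congr Quat; rewrite /= ?addr0 // /qnorm2 /=; ring.
  by rewrite -(qmul1_inv (vertex_at_conj b)) !mulr_natl mulrnAr.
have := qredM phi_sqr (qred_vertex phi_sqr a) (qred_conj (qred_vertex phi_sqr b)).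
rewrite outer_adj -mulmxA (mulmxA (rvec _)) rvec_cvec mul_scalar_mx -scalemxAr.
congr (qred _ _ (_ *: _)); rewrite /det2 /=; ring.
Qed.

Definition alt_prod (L : seq (option 'I_4 * option 'I_4)) : quaternion R :=
  \prod_(l <- L) (vertex_at phi l.1 * (vertex_at phi l.2)^-1).

(** Distinct terms inside a pair have distinct coimages, and distinct terms on either side of a
    junction of pairs have distinct images; so every determinant that enters the scalar [c] is
    nonzero. *)
Lemma qred_alt_prod a b L :
  path (fun a b => a != b) a (b :: flatten [seq [:: l.1; l.2] | l <- L]) ->
  exists2 c, c != 0 & qred phi (2 ^+ (size L).+1 * alt_prod ((a, b) :: L))
    (c *: (cvec (img a) *m rvec (perp (img (last (a, b) L).2)))).
Proof.
rewrite /alt_prod; elim: L a b => [|[a' b'] L IHL] a b /=.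
  rewrite andbT => ab; exists (det2 (coimg b) (coimg a)); first by
    rewrite coimg_det // eq_sym.
  by rewrite big_seq1 expr1; apply: qred_pair.
case/and3P=> ab ba' /IHL[c c0 red_c].
exists (det2 (coimg b) (coimg a) * det2 (img b) (img a') * c).
  by rewrite !F4_mulf_neq0 ?img_det ?coimg_det // eq_sym.
have := qredM phi_sqr (qred_pair a b) red_c.
rewrite [in X in _ -> X]big_cons.
congr (qred _ _ _).
  rewrite [X in _ = X * _](exprS 2 (size L).+1) -!mulrA; congr (2 * _).
  rewrite !mulrA; congr (_ * _); rewrite -[RHS]mulrA -natrX.
  exact: (commr_nat (vertex_at phi a / vertex_at phi b)).
rewrite -scalemxAl -scalemxAr scalerA mulmxA -(mulmxA (cvec _)) rvec_cvec.
rewrite mul_mx_scalar -scalemxAl scalerA; congr (_ *: _).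
by rewrite /det2 /=; ring.
Qed.

(** By cyclicity, the trace pairs [perp (img b')], for the last term [b'], with the image of [a]
    shifted by i_k. The reduced trace is twice the real part, whence one factor 2 more than the
    number of pairs. *)
Lemma zred_alt_coord a b L k :
  path (fun a b => a != b) a (b :: flatten [seq [:: l.1; l.2] | l <- L]) ->
  (last (a, b) L).2 != omap (simplex_perm k) a ->
  exists2 c, c != 0 &
    zred phi (2 ^+ (size L).+2 * qcoord (alt_prod ((a, b) :: L)) k) c.
Proof.
move=> /qred_alt_prod[c c0 red_c] ne.
set b' := (last _ _).2 in red_c ne.
exists (c * det2 (img b') (img (omap (simplex_perm k) a))).
  by rewrite F4_mulf_neq0 ?img_det.
have := qred_trace (qredM phi_sqr red_c (qred_qbasis phi_sqr k)).
rewrite -scalemxAl -mulmxA linearZ /= mxtrace_mulC -mulmxA unit_shift_img.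
rewrite rvec_cvec /mxtrace big_ord1 !mxE mulr1n; congr (zred _ _ _).
  rewrite qcoordE [in RHS]exprS -!mulrA; congr (_ * _).
  by rewrite -!natrX -qre_natl mulrA.
Qed.

End AlternatingProduct.

(** * Odd algebraic integers *)

Section Oddness.
Variable R : realType.
Implicit Types y : R.

Lemma half_not_alg_int : ~ alg_int (1 / 2 : R).
Proof.
case=> q mon_q; rewrite /root horner_coef size_map_inj_poly ?rmorph0 //; last exact: intr_inj.
set n := size q => /eqP q0.
have n_gt0 : (0 < n)%N by rewrite size_poly_gt0 monic_neq0.
(* Clearing denominators with 2 to the degree of [q] leaves an integer sum in which only the leading
   term, 1, is odd. *)
have : (\sum_(i < n) q`_i * 2 ^+ (n.-1 - i))%:~R = 0 :> R.
  rewrite -[RHS](mulr0 (2 ^+ n.-1)) -q0 mulr_sumr rmorph_sum /=.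
  apply: eq_bigr => i _; rewrite coef_map /= rmorphM rmorphXn /= mulrCA; congr (_ * _).
  by rewrite div1r exprVn exprB ?unitfE ?pnatr_eq0 // -ltnS prednK.
move/eqP; rewrite intr_eq0 -(prednK n_gt0) big_ord_recr /= subnn mulr1.
rewrite -/(lead_coef q) (eqP mon_q) => /eqP/(congr1 (fun z => z %% 2)%Z).
rewrite (_ : \sum_(i < n.-1) _ = 2 * \sum_(i < n.-1) q`_i * 2 ^+ (n.-1 - i).-1); last first.
  rewrite mulr_sumr; apply: eq_bigr => i _.
  by rewrite mulrCA -exprS prednK // subn_gt0.
by rewrite mulrC modzMDl.
Qed.

Lemma alg_int_nat n : alg_int (n%:R : R).
Proof. exact: integral_nat. Qed.

Lemma alg_int_int (a : int) : alg_int (a%:~R : R).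
Proof. exact: integral_id. Qed.

Variable phi : R.
Hypothesis phi_sqr : phi ^+ 2 = phi + 1.

Lemma alg_int_golden : alg_int phi.
Proof.
exists ('X^2 - ('X + 1%:P)).
  by rewrite monicE lead_coefDl ?lead_coefXn // size_polyN size_XaddC size_polyXn.
rewrite /root rmorphB rmorphD /= map_polyXn map_polyX map_polyC !hornerE /=.
by rewrite phi_sqr subrr.
Qed.

(* m y and 2^N y are algebraic integers with m odd, hence so is y. If y / 2 were
   one too, multiplying by a lift of the inverse of c would give 1 / 2. *)
Lemma odd_zred y c N : zred phi y c -> c != 0 -> alg_int (2 ^+ N * y) -> odd_alg_int y.
Proof.
case=> m [a [b [odd_m yE cE]]] c0 int_y.
have int_p := alg_int_golden.
have int_my : alg_int (m%:R * y).
  by rewrite yE; apply: integral_add; [|apply: integral_mul];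
    first [exact: alg_int_int | exact: int_p].
split.
  have [u [v uv]] : exists u v : int, u * m + v * (2 ^ N)%N = 1.
    have := Bezoutz m (2 ^ N)%N; case=> u [v uv]; exists u, v; rewrite uv.
    by apply/eqP; rewrite -/(coprimez _ _) coprimezE /= coprimeXr // coprimen2.
  rewrite (_ : y = u%:~R * (m%:R * y) + v%:~R * (2 ^+ N * y)).
    by apply: integral_add; apply: integral_mul;
      first [exact: alg_int_int | exact: int_my | exact: int_y].
  have := congr1 (intr : int -> R) uv; rewrite rmorphD !rmorphM /= -!pmulrn natrX => uvR.
  by rewrite !mulrA -mulrDl uvR mul1r.
move=> int_y2; apply: half_not_alg_int.
have [d dc] := F4_inv c0.
have [a' [b' dE]] := F4_basis d.
(* The arguments are the coordinates of (a' + b' phi)(a + b phi), which reduces to d c = 1. *)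
have [|a2 [b2 [odd_A even_B]]] := @F4_eq1 (a' * a + b' * b) (a' * b + b' * a + b' * b).
  have f_sqr : F4_f ^+ 2 = F4_f + 1 by [].
  by rewrite -[RHS]dc cE dE !rmorphD !rmorphM /=; ring: f_sqr.
have pE : (a'%:~R + b'%:~R * phi) * (m%:R * y) = 1 + 2 * (a2%:~R + b2%:~R * phi).
  transitivity ((a' * a + b' * b)%:~R + (a' * b + b' * a + b' * b)%:~R * phi).
    by rewrite yE !rmorphD !rmorphM /=; ring: phi_sqr.
  by rewrite odd_A even_B rmorphD !rmorphM /=; ring.
rewrite (_ : 1 / 2 = (a'%:~R + b'%:~R * phi) * (m%:R * (y / 2)) -
    (a2%:~R + b2%:~R * phi)); last first.
  by rewrite (mulrA m%:R) (mulrA (_ + _)) pE; field.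
have int_Zp (i j : int) : alg_int (i%:~R + j%:~R * phi).
  by apply: integral_add; [|apply: integral_mul]; first [exact: alg_int_int | exact: int_p].
apply: integral_sub; last exact: int_Zp.
apply: integral_mul; first exact: int_Zp.
by apply: integral_mul; [exact: alg_int_nat | exact: int_y2].
Qed.

End Oddness.

(** * Words and their cyclic reduction *)

Section Words.
Variable R : realType.
Implicit Types (x : quaternion R) (s : seq ('I_4 * bool)).

Definition letter_val (l : 'I_4 * bool) : quaternion R :=
  if l.2 then (simplex R l.1)^-1 else simplex R l.1.

Definition word_val s : quaternion R := \prod_(l <- s) letter_val l.

Lemma letter_val_unit l : letter_val l \is a GRing.unit.
Proof. by rewrite /letter_val; case: l.2; rewrite ?unitrV simplex_unit. Qed.

Lemma letter_val_linv l : letter_val (linv l) = (letter_val l)^-1.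
Proof. by rewrite /letter_val /=; case: l.2; rewrite ?invrK. Qed.

Lemma letter_val_perm k l : letter_val (simplex_perm k l.1, l.2) =
  qbasis R k * letter_val l * qconj (qbasis R k).
Proof.
have Uk : qbasis R k \is a GRing.unit.
  apply/unitrP; exists (qconj (qbasis R k)).
  by rewrite qbasis_conj qbasis_conjl.
rewrite (qmul1_inv (qbasis_conj R k)) /letter_val /=.
rewrite -simplex_permE; case: l.2 => //.
have Us := simplex_unit R l.1.
by rewrite [LHS]invrM ?unitrMl ?Uk ?Us ?unitrV // invrK invrM // mulrA.
Qed.

Lemma kcancel_rcons (T : finType) (f : {perm T}) l (s : seq (T * bool)) :
  kcancel f (l :: rcons s (linv (f l.1, l.2))) = s.
Proof.
by case: s => [|l1 s] /=; rewrite ?eqxx // last_rcons eqxx belast_rcons.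
Qed.

Lemma kcancelP (T : finType) (f : {perm T}) (s : seq (T * bool)) :
  kcancel f s = s \/ exists l, s = l :: rcons (kcancel f s) (linv (f l.1, l.2)).
Proof.
case: s => [|l [|l1 s]] /=; [by left | by left |].
case: eqP => [lE|_]; last by left.
by right; exists l; rewrite -[linv _]lE -lastI.
Qed.

(** If v is the value of the cancelled first letter, the last one has value (i_k v i_k^-1)^-1.
    Conjugation by i_k and by i_k^-1 agree, so v^-1 can be moved past [qconj (qbasis R k)], and the
    cancellation becomes a conjugation by v. *)
Lemma word_val_kcancel k s : exists2 q : quaternion R, q \is a GRing.unit &
  word_val s * qconj (qbasis R k) =
  q * (word_val (kcancel (simplex_perm k) s) * qconj (qbasis R k)) / q.
Proof.
have [->|[l sE]] := kcancelP (simplex_perm k) s.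
  by exists 1; rewrite ?unitr1 // mul1r divr1.
exists (letter_val l); first exact: letter_val_unit.
rewrite {1}sE /word_val big_cons big_rcons /=.
rewrite letter_val_linv letter_val_perm qbasis_swap -!mulrA; congr (_ * (_ * _)).
set v := letter_val l; have Uv : v \is a GRing.unit := letter_val_unit l.
rewrite -(@qmul1_inv _ _ (qconj (qbasis R k) * v^-1 * qbasis R k)).
  by rewrite -!mulrA qbasis_conj mulr1.
rewrite !mulrA -(mulrA _ (qbasis R k)) qbasis_conj mulr1 -(mulrA _ v) mulrV // mulr1.
exact: qbasis_conjl.
Qed.

Lemma word_val_kred k (w : free_group 'I_4) :
  exists2 q : quaternion R, q \is a GRing.unit &
  rho R w * qconj (qbasis R k) =
  q * (rho R (kred (simplex_perm k) w) * qconj (qbasis R k)) / q.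
Proof.
rewrite -![rho R _]/(word_val _) /=; elim: (size w) => [|n [q Uq wE]] /=.
  by exists 1; rewrite ?unitr1 // mul1r divr1.
have [q' Uq' sE] := word_val_kcancel k (iter n (kcancel (simplex_perm k)) w).
exists (q * q'); first by rewrite unitrMl.
by rewrite wE sE invrM // !mulrA.
Qed.

Lemma qcoord_rho_kred k w :
  qcoord (rho R (kred (simplex_perm k) w)) k = qcoord (rho R w) k.
Proof.
rewrite !qcoordE; have [q Uq ->] := word_val_kred k w.
by rewrite -(mulrA q) [RHS]qre_comm divrK.
Qed.

Definition golden (e : bool) : R := (1 + (-1) ^+ e * Num.sqrt 5) / 2.

Lemma golden_sqr e : golden e ^+ 2 = golden e + 1.
Proof.
have s5 : Num.sqrt 5 ^+ 2 = 5 :> R by rewrite sqr_sqrtr.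
by rewrite /golden; case: e; field: s5.
Qed.

Definition alt_term (e : bool) (o : option 'I_4) : free_group 'I_4 :=
  if o is Some t then Free (isT : reduced [:: (t, e)]) else 1%g.

(** Changing the sign of sqrt 5 negates the imaginary parts of a vertex, which inverts a unit
    quaternion. *)
Lemma rho_alt_term e o : rho R (alt_term e o) = vertex_at (golden e) o.
Proof.
case: o => [i|]; last exact: free_lift1.
rewrite [LHS]big_seq1 /= /golden /vertex_at; case: e => /=; last first.
  by case: i => -[|[|[|[|//]]]] ?; rewrite /simplex !(tnth_nth 0); congr Quat => /=; field.
have s5 : Num.sqrt 5 ^+ 2 = 5 :> R by rewrite sqr_sqrtr.
apply/esym/qmul1_inv.
by case: i => -[|[|[|[|//]]]] ?; rewrite /simplex !(tnth_nth 0); congr Quat => /=; field: s5.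
Qed.

Definition alt_pairs e (L : seq (option 'I_4 * option 'I_4)) :=
  [seq (alt_term e l.1, alt_term e l.2) | l <- L].

Lemma rho_alt_pairs e L :
  rho R (\prod_(E <- alt_pairs e L) (E.1 * E.2^-1))%g = alt_prod (golden e) L.
Proof.
rewrite big_map /alt_prod.
elim: L => [|l L IHL]; first by rewrite !big_nil; apply: free_lift1.
rewrite !big_cons -IHL -!rho_alt_term /rho.
rewrite !free_liftM; try exact: simplex_unit.
congr (_ * _ * _); apply: qmul1_inv.
by rewrite -free_liftM ?mulgV; [exact: free_lift1 | exact: simplex_unit].
Qed.

End Words.

(** * Alternating pairs expressions *)

Section AlternatingExpressions.
Variable R : realType.

Definition pair_terms (T : Type) (L : seq (T * T)) :=
  flatten [seq [:: l.1; l.2] | l <- L].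

Lemma is_alt_term_alt_term e a : is_alt_term e a -> exists o, a = alt_term e o.
Proof.
case/is_alt_termP => [->|[t ->]]; first by exists None.
by exists (Some t); apply: val_inj.
Qed.

Lemma is_alt_expr_alt_pairs w E : is_alt_expr w E -> exists e L,
  [/\ E = alt_pairs e L, all (is_alt_term e) (pair_terms E) &
      path (fun a b => a != b) None (pair_terms L)].
Proof.
case/and3P=> _ pathE altE.
have [e {}altE] : exists e, all (is_alt_term e) (pair_terms E).
  by case/orP: altE => ?; [exists false | exists true].
have [L EL] : exists L, E = alt_pairs e L.
  elim: {pathE} E altE => [|[a b] E IHE] /=; first by exists [::].
  case/and3P=> /is_alt_term_alt_term[o ->] /is_alt_term_alt_term[o' ->] /IHE[L ->].
  by exists ((o, o') :: L).
exists e, L; split=> //; move: pathE; rewrite EL.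
rewrite (_ : flatten _ = map (alt_term e) (pair_terms L)); last first.
  by rewrite /pair_terms; elim: (L) => //= l L' ->.
rewrite -[1%g]/(alt_term e None) path_map; apply: sub_path => o o' /=.
by apply: contra => /eqP->.
Qed.

Definition pair_letters (E : seq (free_group 'I_4 * free_group 'I_4)) :=
  flatten [seq word p.1 ++ word (p.2)^-1%g | p <- E].

Lemma word_alt_expr w e E : is_alt_expr w E -> all (is_alt_term e) (pair_terms E) ->
  word w = pair_letters E.
Proof.
case/and3P=> /eqP wE pathE _ altE; rewrite prod_letters in wE.
have alt1 : is_alt_term e (1%g : free_group 'I_4) by apply/is_alt_termP; left.
have [red_s _ _] := alt_parseK alt1 pathE altE.
by rewrite wE; rewrite invg1 /= in red_s; rewrite -(free_prod (Free red_s)).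
Qed.

Lemma pair_letters_last e a b L : exists s,
  pair_letters (alt_pairs e ((a, b) :: L)) =
  word (alt_term e a) ++ s ++ word (alt_term e (last (a, b) L).2)^-1%g.
Proof.
elim: L a b => [|[a' b'] L IHL] a b; first by exists [::]; rewrite /pair_letters /= cats0.
have [s sE] := IHL a' b'.
exists (word (alt_term e b)^-1%g ++ word (alt_term e a') ++ s).
rewrite -!catA -[last _ _]/(last (a', b') L) -sE.
by rewrite [RHS]catA.
Qed.

(** The terms concatenate without cancellation, so otherwise the first and last letters of the word
    would cancel, against [kred_stable]. *)
Lemma kred_alt_last f (w : free_group 'I_4) e a b L :
  is_alt_expr (kred f w) (alt_pairs e ((a, b) :: L)) ->
  all (is_alt_term e) (pair_terms (alt_pairs e ((a, b) :: L))) -> a != None ->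
  (last (a, b) L).2 != omap f a.
Proof.
move=> alt_E all_E; have := word_alt_expr alt_E all_E.
case: a {alt_E all_E} => [t|] rE; rewrite ?eqxx // => _.
have [s sE] := pair_letters_last e (Some t) b L; rewrite sE in rE.
apply/eqP => lastE; have := kred_stable f w; rewrite rE lastE /=.
rewrite cats1 [LHS](@kcancel_rcons _ f (t, e)) => /(congr1 size) /=.
by rewrite size_rcons => /eqP; rewrite eqn_leq ltnNge leqnSn andbF.
Qed.

(** * Integrality of the coordinates and the value of [lad] *)

Definition qint (x : quaternion R) := forall k, alg_int (qcoord x k).

Lemma qintP (x : quaternion R) :
  [/\ alg_int (qre x), alg_int (qim1 x), alg_int (qim2 x) & alg_int (qim3 x)] ->
  qint x.
Proof. by case=> ? ? ? ? -[[|[|[|[|//]]]] ?]. Qed.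

Lemma qintM x y : qint x -> qint y -> qint (x * y).
Proof.
move=> hx hy; have := (hx 0, hx 1, hx 2, hx 3, hy 0, hy 1, hy 2, hy 3).
rewrite /qcoord /= => -[[[[[[[x0 x1] x2] x3] y0] y1] y2] y3].
apply: qintP; case: x x0 x1 x2 x3 {hx} => a b c d /= *.
case: y y0 y1 y2 y3 {hy} => a' b' c' d' /= *.
by split; repeat (apply: integral_sub || apply: integral_add || apply: integral_mul).
Qed.

Lemma qint_letter l : qint (4 * letter_val R l).
Proof.
have s5 : Num.sqrt 5 ^+ 2 = 5 :> R by rewrite sqr_sqrtr.
have int5 e : alg_int ((-1) ^+ e * Num.sqrt 5 : R).
  apply: integral_mul.
    by have := integral_id (intr : int -> R) ((-1) ^+ e); rewrite rmorphXn rmorphN1.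
  exists ('X^2 - 5%:P).
    by rewrite monicE lead_coefDl ?lead_coefXn // size_polyN size_polyXn size_polyC.
  by rewrite /root rmorphB /= map_polyXn map_polyC !hornerE /= s5 subrr.
have -> : 4 * letter_val R l = 4 * vertex_at (golden R l.2) (Some l.1).
  by rewrite -(rho_alt_term R l.2 (Some l.1)) /rho /free_lift big_seq1.
have eq_int (y z : R) : alg_int z -> y = z -> alg_int y by move=> ? ->.
rewrite /golden mulr_natl; move: (_ ^+ _ * _) (int5 l.2) => s int_s.
have int_Ns : alg_int (- s) by apply: integral_opp.
have int_N1 : alg_int (- 1 : R) by apply: integral_opp; apply: integral1.
case: (l.1) => -[|[|[|[|//]]]] ?; apply: qintP.
all: rewrite /vertex_at (tnth_nth 0) /=; split.
all: first [apply: (eq_int _ _ int_N1); by field | apply: (eq_int _ _ int_s); by field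
  | apply: (eq_int _ _ int_Ns); by field].
Qed.

(** A crude bound is enough: [odd_zred] asks for some power of 2 that clears the denominators. *)
Lemma qint_word s : qint (4 ^+ size s * word_val R s).
Proof.
elim: s => [|l s IHs].
  rewrite /word_val big_nil mulr1; apply: qintP.
  by split; [apply: (alg_int_nat _ 1) | apply: integral0..].
rewrite /word_val big_cons [size _]/= exprS.
rewrite (_ : _ * _ = (4 * letter_val R l) * (4 ^+ size s * word_val R s)).
  exact/qintM/IHs/qint_letter.
rewrite -!mulrA; congr (_ * _); rewrite !mulrA; congr (_ * _).
by rewrite -natrX; apply/esym/commr_nat.
Qed.

Lemma has_lad_kred k w : kred (simplex_perm k) w != 1%g ->
  has_lad (qcoord (rho R (kred (simplex_perm k) w)) k) (kalt_norm (simplex_perm k) w)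
  /\ (0 < kalt_norm (simplex_perm k) w)%N.
Proof.
set r := kred _ _ => r1.
have [E alt_E] := alt_expr_exists r.
have [e [L [EL all_E pathL]]] := is_alt_expr_alt_pairs alt_E.
rewrite /kalt_norm -/r (alt_normE alt_E); rewrite {}EL in alt_E all_E *.
have rE : rho R r = alt_prod (golden R e) L.
  by case/and3P: alt_E => /eqP{1}-> _ _; apply: rho_alt_pairs.
case: L => [|[a b] L] in alt_E all_E pathL rE *.
  by case/and3P: alt_E r1 => /eqP{1}->; rewrite big_nil eqxx.
rewrite size_map; split=> //.
have [a0 pathL'] : a != None /\ path (fun a b => a != b) a (b :: pair_terms L).
  by move: pathL => /= /andP[]; rewrite eq_sym.
have [c c0 red_c] := zred_alt_coord (golden_sqr R e) pathL' (kred_alt_last alt_E all_E a0).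
rewrite -rE in red_c.
(* There are n = [(size L).+1] pairs, so the exponent is n + 1. *)
exists (2 ^+ (size L).+2 * qcoord (rho R r) k).
  apply: (odd_zred (golden_sqr R e) (N := 2 * size (word r)) red_c c0).
  rewrite mulrCA; apply: integral_mul.
    by rewrite -natrX; apply: alg_int_nat.
  have := qint_word (word r) k; congr (alg_int _).
  by rewrite !qcoordE -natrX -mulrA qre_natl exprM -!natrX.
rewrite -PoszD addn1 -exprnP mulrC mulKf //.
by rewrite expf_eq0 pnatr_eq0.
Qed.

Lemma lad_kred k w : kred (simplex_perm k) w != 1%g ->
  lad (qcoord (rho R w) k) = (kalt_norm (simplex_perm k) w : int)%:E
  /\ (0 < kalt_norm (simplex_perm k) w)%N.
Proof. by move=> /has_lad_kred[/ladP]; rewrite qcoord_rho_kred. Qed.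

Lemma alt_norm1 (T : finType) : alt_norm (1%g : free_group T) = 0%N.
Proof. by rewrite (@alt_normE _ _ [::]) // /is_alt_expr /= big_nil eqxx. Qed.

End AlternatingExpressions.

Theorem theorem2 (R : realType) (w : free_group 'I_4) (k : 'I_4) :
  let x := rho R w in
  let red_norm := kalt_norm (simplex_perm k) w in
  let cond_a := red_norm = 0%N in
  let cond_b := kred (simplex_perm k) w = 1%g in
  let cond_c := (k = 0 /\ x = 1) \/ (0 < k)%N /\ qcoord x k = 0 in
  [/\ cond_a <-> cond_b, cond_b <-> cond_c
    & ~ cond_a -> lad (qcoord x k) = (red_norm%:Z)%:E /\ (1 <= red_norm)%N].
Proof.
move=> x red_norm cond_a cond_b cond_c.
have lad_x : ~ cond_b -> lad (qcoord x k) = (red_norm%:Z)%:E /\ (1 <= red_norm)%N.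
  by move=> /eqP/(lad_kred R).
have b_a : cond_b -> cond_a.
  by rewrite /cond_b /cond_a /red_norm /kalt_norm => ->; apply: alt_norm1.
have a_b : cond_a -> cond_b.
  by rewrite /cond_a => a; apply: contrapT => /lad_x[_]; rewrite a.
have b_c : cond_b -> cond_c.
  rewrite /cond_b /cond_c => b; have [k0|k0] := posnP k; [left | right; split=> //].
    have k0' : k = 0 by apply: val_inj.
    have i0 : qconj (qbasis R k) = 1 by rewrite k0'; congr Quat; rewrite /= ?oppr0.
    split=> //; have [q Uq] := word_val_kred R k w; rewrite b /rho free_lift1 i0.
    by rewrite !mulr1 mulrV.
  rewrite -qcoord_rho_kred b /rho free_lift1.
  by case: (k) k0 => -[|[|[|[|//]]]].
have c_b : cond_c -> cond_b.
  (* Under (c) the value of [lad] is -1 (as 1 is odd and equals 1 / 2^0) or -oo, never a natural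
     number. *)
  move=> c; apply: contrapT => nb; have [] := lad_x nb; case: c => [[k0 x1]|[_ ->]].
    rewrite x1 k0.
    have -> : lad (qcoord (1 : quaternion R) 0) = ((-1)%:E)%E.
      apply/ladP; exists 1; last by rewrite addNr expr0z divr1.
      split; [exact: (alg_int_nat R 1) | exact: half_not_alg_int].
    by case.
  by rewrite /lad eqxx.
split; [by split | by split | by move=> na; apply: lad_x => /b_a].
Qed.
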